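(* Let $E\subset\mathbb{R}^2$ be a boundary element with nodal basis vector $\boldsymbol{\phi}(\boldsymbol{x})\in\mathbb{R}^{N}$, let $\tilde{\boldsymbol{x}}$ be a point of the surrogate boundary on $E$, let $\bar{\boldsymbol{x}}$ be the corresponding point of the true boundary, let $\boldsymbol{u}\in\mathbb{R}^{N}$ be the coefficient vector of the internal polynomial $u_h(\boldsymbol{x})=\boldsymbol{\phi}^T(\boldsymbol{x})\boldsymbol{u}$, and let $u_D\in\mathbb{R}$ be the Dirichlet value prescribed at $\bar{\boldsymbol{x}}$. Let $\boldsymbol{v}\in\mathbb{R}^{N}$ be the solution, obtained by inversion, of the linear system $$\boldsymbol{v} - \boldsymbol{u} + (\boldsymbol{\phi}^T(\bar{\boldsymbol{x}}) \boldsymbol{v} - u_D)\, \boldsymbol{\phi}(\bar{\boldsymbol{x}}) = \boldsymbol{0},$$ and let $\tilde u_D:=\boldsymbol{\phi}(\tilde{\boldsymbol{x}})^T\boldsymbol{v}$ be the ROD-E-w modified Dirichlet boundary condition at $\tilde{\boldsymbol{x}}$. Then $$\tilde u_D = [\boldsymbol{\phi}(\tilde{\boldsymbol{x}}) - \alpha\, \boldsymbol{\phi}(\bar{\boldsymbol{x}})]^T \boldsymbol{u} + \alpha\, u_D,\qquad \alpha = \frac{\boldsymbol{\phi}(\tilde{\boldsymbol{x}})^T \boldsymbol{\phi}(\bar{\boldsymbol{x}})}{1+\|\boldsymbol{\phi}(\bar{\boldsymbol{x}})\|^2_2}.$$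
   Context: The boundary element $E$ is an affine image of the reference square $[-1,1]^2$. For a polynomial degree $p\ge 1$ and $N=(p+1)^2$, $\boldsymbol{\phi}=[\phi_1,\ldots,\phi_N]^T$ is the vector of nodal (Lagrange) basis polynomials on $E$, namely the tensor-product Lagrange polynomials of degree $p$ in each variable associated with the tensor-product Gauss-Lobatto-Legendre points. As polynomials they are also evaluated at points outside $E$, so $\boldsymbol{\phi}(\bar{\boldsymbol{x}})$ makes sense even when $\bar{\boldsymbol{x}}\notin E$. $\|\cdot\|_2$ is the Euclidean norm on $\mathbb{R}^N$. The surrogate boundary is the boundary of the unfitted computational mesh to which $E$ belongs; each of its points $\tilde{\boldsymbol{x}}$ is mapped to a point $\bar{\boldsymbol{x}}$ of the true boundary of the physical domain, where the boundary condition is prescribed. The linear system is the optimality condition of the functional $\mathcal{L}(\boldsymbol{v})=\frac12\|\boldsymbol{v}-\boldsymbol{u}\|_2^2+\frac12(\boldsymbol{\phi}(\bar{\boldsymbol{x}})^T\boldsymbol{v}-u_D)^2$. *)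

(* Defs.v *)
From HB Require Import structures.
From mathcomp Require Import all_boot all_order all_algebra.
From mathcomp Require Import all_classical all_reals all_analysis.

Set Implicit Arguments.
Unset Strict Implicit.
Unset Printing Implicit Defensive.

Import Order.TTheory GRing.Theory Num.Theory.
Import numFieldNormedType.Exports.

Local Open Scope classical_set_scope.
Local Open Scope ring_scope.

(* Rodrigues' formula; [^`N(p)] already contains the factor 1 / p!. *)
Definition legendre (R : realType) (p : nat) : {poly R} :=
  (2 ^- p) *: (('X^2 - 1) ^+ p)^`N(p).

(* The polynomial (1 - X^2) P_p' has degree p + 1, so for p >= 1 its p + 1
   roots listed in increasing order are exactly the points z. *)
Definition gauss_lobatto_legendre (R : realType) (p : nat)
    (z : 'I_p.+1 -> R) : Prop :=
  (forall i j : 'I_p.+1, (i < j)%N -> z i < z j) /\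
  (forall i, root ((1 - 'X^2) * (legendre R p)^`()) (z i)).

Definition lagrange_basis (R : realType) (p : nat) (z : 'I_p.+1 -> R)
    (i : 'I_p.+1) : {poly R} :=
  \prod_(j < p.+1 | j != i) ((z i - z j)^-1 *: ('X - (z j)%:P)).

Definition reference_square (R : realType) : set 'cV[R]_2 :=
  [set xi | forall i, -1 <= xi i 0 <= 1].

(* An element is given by its affine chart xi |-> el_mx *m xi + el_vec, since
   the nodal basis depends on the chart and not only on the image set. *)
Record element (R : realType) := Element {
  el_mx : 'M[R]_2;
  el_vec : 'cV[R]_2;
  el_mx_unit : el_mx \in unitmx }.

Definition element_chart (R : realType) (E : element R) (xi : 'cV[R]_2) :
    'cV[R]_2 := el_mx E *m xi + el_vec E.

Definition element_chart_inv (R : realType) (E : element R) (x : 'cV[R]_2) :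
    'cV[R]_2 := invmx (el_mx E) *m (x - el_vec E).

Definition element_set (R : realType) (E : element R) : set 'cV[R]_2 :=
  element_chart E @` reference_square (R:=R).

(* The (p + 1)^2 tensor-product nodal polynomials, numbered row by row and
   defined on the whole plane. *)
Definition nodal_basis (R : realType) (p : nat) (z : 'I_p.+1 -> R)
    (E : element R) (x : 'cV[R]_2) : 'cV[R]_(p.+1 * p.+1) :=
  let xi := element_chart_inv E x in
  (mxvec (\matrix_(i < p.+1, j < p.+1)
     ((lagrange_basis z i).[xi 0 0] * (lagrange_basis z j).[xi 1 0])))^T.

Definition dot (R : realType) (n : nat) (a b : 'cV[R]_n) : R :=
  (a^T *m b) 0 0.

(* The library's norm on matrices is the maximum norm. *)
Definition norm2 (R : realType) (n : nat) (a : 'cV[R]_n) : R :=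
  Num.sqrt (\sum_(i < n) `|a i 0| ^+ 2).

Definition frontier (T : topologicalType) (A : set T) : set T :=
  closure A `\` interior A.

Definition nonoverlapping (R : realType) (m : nat)
    (mesh : 'I_m -> element R) : Prop :=
  forall i j, i != j ->
    interior (element_set (mesh i)) `&` interior (element_set (mesh j)) = set0.

Definition surrogate_boundary (R : realType) (m : nat)
    (mesh : 'I_m -> element R) : set 'cV[R]_2 :=
  frontier [set x | exists i, element_set (mesh i) x].

Definition rodew_system (R : realType) (n : nat) (phib u : 'cV[R]_n) (uD : R)
    (v : 'cV[R]_n) : Prop :=
  v - u + (dot phib v - uD) *: phib = 0.

(* Main.v *)
Require Import Defs.
From HB Require Import structures.
From mathcomp Require Import all_boot all_order all_algebra.
From mathcomp Require Import all_classical all_reals all_analysis.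
From mathcomp Require Import ring lra.

(** The residual [b^T v - uD] of the boundary condition determines [v], since
    the system reads [v = u - (b^T v - uD) b] with [b] the basis vector at the
    point of the true boundary.  Taking the product with [b] turns it into a
    scalar equation for the residual [t], namely
    [(1 + |b|^2) t = b^T u - uD], which is uniquely solvable because
    [1 + |b|^2 > 0].  Hence the system has exactly one solution, a Sherman-Morrison
    formula for the rank-one perturbation [1 + b b^T] of the identity
    ([rodew_systemP]).  Pairing that solution with the basis vector at the
    surrogate point and collecting the terms in [u] and [uD] gives the modified
    boundary value ([dot_rodew_solution]). *)

Set Implicit Arguments.
Unset Strict Implicit.
Unset Printing Implicit Defensive.

Import Order.TTheory GRing.Theory Num.Theory.
Import numFieldNormedType.Exports.

Local Open Scope classical_set_scope.
Local Open Scope ring_scope.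

Lemma dotC (R : realType) (n : nat) (a b : 'cV[R]_n) : dot a b = dot b a.
Proof.
by rewrite /dot !mxE; apply: eq_bigr => i _; rewrite !mxE mulrC.
Qed.

Lemma dotBr (R : realType) (n : nat) (a b c : 'cV[R]_n) :
  dot a (b - c) = dot a b - dot a c.
Proof. by rewrite /dot mulmxBr !mxE. Qed.

Lemma dotZr (R : realType) (n : nat) (k : R) (a b : 'cV[R]_n) :
  dot a (k *: b) = k * dot a b.
Proof. by rewrite /dot -scalemxAr mxE. Qed.

Lemma sqr_norm2 (R : realType) (n : nat) (a : 'cV[R]_n) :
  norm2 a ^+ 2 = dot a a.
Proof.
rewrite /norm2 sqr_sqrtr; last by apply: sumr_ge0 => i _; exact: sqr_ge0.
by rewrite /dot mxE; apply: eq_bigr => i _; rewrite !mxE real_normK ?num_real.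
Qed.

Lemma add1_sqr_norm2_neq0 (R : realType) (n : nat) (a : 'cV[R]_n) :
  1 + norm2 a ^+ 2 != 0.
Proof. by rewrite gt_eqF// ltr_wpDr ?sqr_ge0. Qed.

(** Multiplying [v = u - t b], with [t] the residual of [v], by [b^T] gives
    [t = b^T u - uD - t |b|^2], which fixes [t]; conversely the vector
    with this value of [t] has residual [t]. *)
Lemma rodew_systemP (R : realType) (n : nat) (b u : 'cV[R]_n) (uD : R)
    (v : 'cV[R]_n) :
  rodew_system b u uD v <->
  v = u - ((dot b u - uD) / (1 + norm2 b ^+ 2)) *: b.
Proof.
have nz := add1_sqr_norm2_neq0 b.
rewrite /rodew_system; split=> [sys|->].
  have vE : v = u - (dot b v - uD) *: b.
    by apply/eqP; rewrite -subr_eq0 opprB addrA addrAC sys.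
  have dotE : dot b v = dot b u - (dot b v - uD) * norm2 b ^+ 2.
    by rewrite {1}vE dotBr dotZr sqr_norm2.
  suff -> : (dot b u - uD) / (1 + norm2 b ^+ 2) = dot b v - uD by [].
  apply: (canLR (mulfK nz)); lra.
rewrite dotBr dotZr -sqr_norm2.
set k := (dot b u - uD) / _.
have kE : k * (1 + norm2 b ^+ 2) = dot b u - uD by rewrite divfK.
have -> : dot b u - k * norm2 b ^+ 2 - uD = k by lra.
by rewrite addrAC subrK subrr.
Qed.

Lemma dot_rodew_solution (R : realType) (n : nat) (a b u v : 'cV[R]_n)
    (uD : R) :
  let alpha := dot a b / (1 + norm2 b ^+ 2) in
  rodew_system b u uD v ->
  dot a v = dot (a - alpha *: b) u + alpha * uD.
Proof.
move=> alpha /rodew_systemP ->.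
rewrite dotBr dotZr [dot (a - _) u]dotC dotBr dotZr.
by rewrite (dotC u a) (dotC u b) /alpha; ring.
Qed.

Theorem proposition3 (R : realType)
    (p : nat) (hp : (1 <= p)%N)
    (z : 'I_p.+1 -> R) (hz : gauss_lobatto_legendre z)
    (m : nat) (mesh : 'I_m -> element R) (hmesh : nonoverlapping mesh)
    (Omega : set 'cV[R]_2)
    (M : 'cV[R]_2 -> 'cV[R]_2)
    (hM : forall x, surrogate_boundary mesh x -> frontier Omega (M x))
    (gD : 'cV[R]_2 -> R)
    (e : 'I_m) (xt : 'cV[R]_2)
    (hxt : surrogate_boundary mesh xt) (hxtE : element_set (mesh e) xt)
    (xb : 'cV[R]_2) (hxb : xb = M xt)
    (u : 'cV[R]_(p.+1 * p.+1)) (uD : R) (huD : uD = gD xb) :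
  let phi := nodal_basis z (mesh e) in
  let alpha := dot (phi xt) (phi xb) / (1 + norm2 (phi xb) ^+ 2) in
  (exists! v, rodew_system (phi xb) u uD v) /\
  (forall v, rodew_system (phi xb) u uD v ->
     let uDt := dot (phi xt) v in
     uDt = dot (phi xt - alpha *: phi xb) u + alpha * uD).
Proof.
move=> phi alpha; split; last by move=> v; exact: dot_rodew_solution.
eexists; split; first by apply/rodew_systemP; reflexivity.
by move=> v /rodew_systemP ->.
Qed.
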